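(* Let $n\ge0$ and let $w_1,w_2\in\mathbb{N}$ with $w_1\equiv1\pmod2$ and $w_2\equiv1\pmod2$. Then, for all $x$ (as an identity of polynomials in $x$), \[ \sum_{l=0}^{w_1-1}(-1)^lC_{n,w_1}\!\left(w_2x+\frac{w_2}{w_1}l\right)=\sum_{l=0}^{w_2-1}(-1)^lC_{n,w_2}\!\left(w_1x+\frac{w_1}{w_2}l\right). \]
   Context: For $w\in\mathbb{N}$, the $w$-Catalan polynomials $C_{n,w}(x)$ are defined by the generating function $\frac{2}{1+(1-4t)^{w/2}}(1-4t)^{\frac{w}{2}x}=\sum_{n\ge0}C_{n,w}(x)t^n$, where $(1-4t)^{a}=\sum_{k\ge0}\binom{a}{k}(-4t)^k$ and $\binom{a}{k}=\frac{a(a-1)\cdots(a-k+1)}{k!}$. *)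

(* Defs.v *)
From HB Require Import structures.
From mathcomp Require Import all_boot all_order all_algebra.

Set Implicit Arguments.
Unset Strict Implicit.
Unset Printing Implicit Defensive.

Import GRing.Theory.
Local Open Scope ring_scope.

(* A formal power series \sum_n (f n) t^n is its coefficient sequence. *)
Definition fps (R : Type) : Type := nat -> R.

Section PowerSeries.
Variable R : comUnitRingType.
Implicit Types (f g : fps R) (a c : R).

Definition fps_const c : fps R := fun n => if n == 0%N then c else 0.

Definition fps_add f g : fps R := fun n => f n + g n.

Definition fps_mul f g : fps R := fun n => \sum_(i < n.+1) f i * g (n - i)%N.

(* First n coefficients of 1 / f, obtained by solving                         *)
(* \sum_(i <= m) f (m - i) * s`_i = (m == 0) successively for s`_m.           *)
Fixpoint fps_inv_coefs f (n : nat) : seq R :=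
  if n is m.+1 then
    let s := fps_inv_coefs f m in
    rcons s (((m == 0%N)%:R - \sum_(i < m) f (m - i)%N * s`_i) / f 0%N)
  else [::].

(* Meaningful only when f 0 is a unit; see fps_mulfV. *)
Definition fps_inv f : fps R := fun n => (fps_inv_coefs f n.+1)`_n.

Definition fps_div f g : fps R := fps_mul f (fps_inv g).

(* Used over {poly rat}, where k`!%:R is a unit. *)
Definition gbinom a (k : nat) : R := (\prod_(i < k) (a - i%:R)) / k`!%:R.

(* (1 - 4t)^a, by the binomial series. *)
Definition pow_1m4t a : fps R := fun k => gbinom a k * (-4) ^+ k.

Lemma size_fps_inv_coefs f n : size (fps_inv_coefs f n) = n.
Proof. by elim: n => //= n IHn; rewrite size_rcons IHn. Qed.

Lemma nth_fps_inv_coefs f n i :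
  (i < n)%N -> (fps_inv_coefs f n)`_i = fps_inv f i.
Proof.
elim: n => // n IHn; rewrite ltnS leq_eqVlt => /orP[/eqP->//|lt_in].
by rewrite /= nth_rcons size_fps_inv_coefs lt_in IHn.
Qed.

Lemma fps_mulfV f :
  f 0%N \is a GRing.unit -> fps_mul f (fps_inv f) =1 fps_const 1.
Proof.
move=> f0U n; rewrite /fps_mul big_ord_recl /= subn0.
rewrite {1}/fps_inv /= nth_rcons size_fps_inv_coefs ltnn eqxx.
rewrite mulrC divrK //.
rewrite [X in _ - X + _](_ : _ = \sum_(i < n) f (bump 0 i) * fps_inv f (n - bump 0 i)%N).
  by rewrite subrK /fps_const; case: eqP.
rewrite (reindex_inj rev_ord_inj) /=; apply: eq_bigr => i _.
rewrite nth_fps_inv_coefs; last by rewrite ltn_subrL (leq_ltn_trans _ (ltn_ord i)).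
by rewrite /bump /= add1n subKn.
Qed.

End PowerSeries.

(* The coefficient ring is {poly rat}: the parameter x is the variable 'X. *)
Definition wCatalan_gf (w : nat) : fps {poly rat} :=
  let h : {poly rat} := (w%:R / 2)%:P in
  fps_mul
    (fps_div (fps_const 2) (fps_add (fps_const 1) (pow_1m4t h)))
    (pow_1m4t (h * 'X)).

Definition wCatalan (n w : nat) : {poly rat} := wCatalan_gf w n.

Lemma wCatalan_den_unit (w : nat) :
  fps_add (fps_const 1) (pow_1m4t ((w%:R / 2)%:P : {poly rat})) 0%N
    \is a GRing.unit.
Proof.
rewrite /fps_add /fps_const /pow_1m4t /gbinom /= big_ord0 divr1 mulr1.
by rewrite -polyC1 -polyCD poly_unitE size_polyC coefC.
Qed.

(* Main.v *)
Require Import Defs.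
From HB Require Import structures.
From mathcomp Require Import all_boot all_order all_algebra.
From mathcomp Require Import ring.

(** Write [P a] for (1 - 4t)^a and [D w] for 1 + P (w/2).  The Vandermonde
    convolution gives P (a + b) = P a * P b, so the generating function of the
    left-hand side, multiplied by [D w1], is
    2 * \sum_(l < w1) (-1)^l P (w1 w2 x / 2 + l w2 / 2).  Multiplying by [D w2]
    makes the alternating sum telescope to
    2 * (P (w1 w2 x / 2) + P (w1 w2 x / 2 + w1 w2 / 2)) because w1 is odd.
    This is symmetric in w1 and w2, and D w1 * D w2 can be cancelled. *)

Set Implicit Arguments.
Unset Strict Implicit.
Unset Printing Implicit Defensive.

Import GRing.Theory.
Local Open Scope ring_scope.

Section FpsTheory.
Variable R : comUnitRingType.
Implicit Types (f g h : fps R) (a b c : R).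

Lemma eq_fps_mul f1 f2 g1 g2 :
  f1 =1 f2 -> g1 =1 g2 -> fps_mul f1 g1 =1 fps_mul f2 g2.
Proof. by move=> ef eg n; apply: eq_bigr => i _; rewrite ef eg. Qed.

(** Coefficients up to [n] of a product involve only coefficients up to [n] of the factors, so
    truncation is harmless. This lets [fps_mul] inherit commutativity and associativity from
    [{poly R}]. *)
Lemma fps_mul_coef_poly N n f g : (n < N)%N ->
  fps_mul f g n = ((\poly_(i < N) f i) * (\poly_(i < N) g i))`_n.
Proof.
move=> ltnN; rewrite coefM; apply: eq_bigr => i _; rewrite !coef_poly.
by rewrite !(leq_ltn_trans _ ltnN) // ?leq_subr // -ltnS.
Qed.

Lemma fps_mulC f g : fps_mul f g =1 fps_mul g f.
Proof. by move=> n; rewrite !(fps_mul_coef_poly _ _ (ltnSn n)) mulrC. Qed.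

Lemma fps_mulA f g h : fps_mul f (fps_mul g h) =1 fps_mul (fps_mul f g) h.
Proof.
move=> n; pose T f := \poly_(i < n.+1) f i.
transitivity ((T f * (T g * T h))`_n).
  rewrite coefM; apply: eq_bigr => i _.
  rewrite coef_poly ltn_ord; congr (_ * _).
  by rewrite (@fps_mul_coef_poly n.+1) // ltnS leq_subr.
rewrite mulrA coefM; apply: eq_bigr => i _.
rewrite [(T h)`_ _]coef_poly ltnS leq_subr; congr (_ * _).
by rewrite (@fps_mul_coef_poly n.+1).
Qed.

Lemma fps_mulCA f g h : fps_mul f (fps_mul g h) =1 fps_mul g (fps_mul f h).
Proof.
move=> n; rewrite fps_mulA [RHS]fps_mulA.
by apply: eq_fps_mul => // k; apply: fps_mulC.
Qed.

Lemma fps_mul_constl c f n : fps_mul (fps_const c) f n = c * f n.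
Proof.
rewrite /fps_mul big_ord_recl subn0 big1 ?addr0 // => i _.
by rewrite /fps_const /= mul0r.
Qed.

Lemma fps_mulDl f g h n :
  fps_mul (fps_add f g) h n = fps_mul f h n + fps_mul g h n.
Proof. by rewrite -big_split; apply: eq_bigr => i _; rewrite mulrDl. Qed.

Lemma fps_mul_sumr (I : finType) (c : I -> R) f (g : I -> fps R) n :
  fps_mul f (fun k => \sum_i c i * g i k) n = \sum_i c i * fps_mul f (g i) n.
Proof.
transitivity (\sum_(j < n.+1) \sum_i c i * (f j * g i (n - j)%N)).
  by apply: eq_bigr => j _; rewrite mulr_sumr; apply: eq_bigr => i _; ring.
by rewrite exchange_big; apply: eq_bigr => i _; rewrite mulr_sumr.
Qed.

Lemma fps_mul_inj f g h : f 0%N \is a GRing.unit ->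
  fps_mul f g =1 fps_mul f h -> g =1 h.
Proof.
move=> f0U e.
have mulVK u : fps_mul (fps_inv f) (fps_mul f u) =1 u.
  move=> n; rewrite fps_mulCA fps_mulA -[RHS]mul1r -fps_mul_constl.
  by apply: eq_fps_mul => //; apply: fps_mulfV.
by move=> n; rewrite -mulVK -[RHS]mulVK; apply: eq_fps_mul.
Qed.

(** The intended ring [{poly rat}] is not a field; this makes the division by k! in [gbinom] a
    genuine one. *)
Hypothesis natU : forall k, k.+1%:R \is a @GRing.unit R.

Lemma fact_unit k : k`!%:R \is a @GRing.unit R.
Proof. by rewrite -(prednK (fact_gt0 k)). Qed.

Lemma gbinomS a k : k.+1%:R * gbinom a k.+1 = (a - k%:R) * gbinom a k.
Proof.
rewrite /gbinom big_ord_recr /= factS natrM invrM ?natU ?fact_unit //.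
rewrite mulrC -!mulrA mulVr ?natU // mulr1; ring.
Qed.

(** Vandermonde convolution, by induction on [n] through the recurrence [gbinomS], which holds for
    an arbitrary upper argument. *)
Lemma gbinomD a b n :
  gbinom (a + b) n = \sum_(i < n.+1) gbinom a i * gbinom b (n - i)%N.
Proof.
elim: n => [|n IHn].
  by rewrite big_ord_recl big_ord0 /gbinom !big_ord0 fact0 divr1 mulr1 addr0.
apply: (mulrI (natU n)); rewrite gbinomS IHn !mulr_sumr.
(* Split the factor n+1 as i + (n+1-i), so that [gbinomS] can absorb each summand into one of the
   two binomials. *)
transitivity (\sum_(i < n.+2)
    (i%:R * gbinom a i * gbinom b (n.+1 - i)
     + gbinom a i * ((n.+1 - i)%:R * gbinom b (n.+1 - i)%N))); last first.
  apply: eq_bigr => i _.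
  have -> : n.+1%:R = i%:R + (n.+1 - i)%:R :> R.
    by rewrite -natrD subnKC // -ltnS.
  ring.
(* The first sum loses its term i = 0 and the second its term i = n+1. Shifting the first index,
   both run over i <= n and combine by (a - i) + (b - (n-i)) = a + b - n. *)
rewrite big_split /= [X in _ = X + _]big_ord_recl /= !mul0r add0r.
rewrite [X in _ = _ + X]big_ord_recr /= subnn mul0r mulr0 addr0 -big_split /=.
apply: eq_bigr => i _; rewrite /bump /= add1n gbinomS subSS.
have lein : (i <= n)%N by rewrite -ltnS.
have -> : n%:R = i%:R + (n - i)%:R :> R by rewrite -natrD subnKC.
rewrite subSn // gbinomS; ring.
Qed.

Lemma pow_1m4tD a b :
  pow_1m4t (a + b) =1 fps_mul (pow_1m4t a) (pow_1m4t b).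
Proof.
move=> n; rewrite /pow_1m4t gbinomD mulr_suml; apply: eq_bigr => i _.
have -> : (-4) ^+ n = (-4) ^+ i * (-4) ^+ (n - i) :> R.
  by rewrite -exprD subnKC // -ltnS.
ring.
Qed.

Lemma fps_mul_1Dpow_1m4t a b n :
  fps_mul (fps_add (fps_const 1) (pow_1m4t a)) (pow_1m4t b) n
  = pow_1m4t b n + pow_1m4t (b + a) n.
Proof. by rewrite fps_mulDl fps_mul_constl mul1r [b + a]addrC pow_1m4tD. Qed.

End FpsTheory.

Lemma fps_mul_map (R S : comUnitRingType) (phi : {rmorphism R -> S})
    (f g : fps R) n :
  phi (fps_mul f g n) = fps_mul (phi \o f) (phi \o g) n.
Proof. by rewrite rmorph_sum; apply: eq_bigr => i _; rewrite rmorphM. Qed.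

Lemma pow_1m4t_map (R S : comUnitRingType) (phi : {rmorphism R -> S})
    (natU : forall k, k.+1%:R \is a @GRing.unit R) (a : R) n :
  phi (pow_1m4t a n) = pow_1m4t (phi a) n.
Proof.
rewrite /pow_1m4t /gbinom rmorphM rmorphXn rmorphN rmorph_nat.
rewrite rmorph_div ?fact_unit // rmorph_nat rmorph_prod.
congr (_ / _ * _); apply: eq_bigr => i _.
by rewrite rmorphB rmorph_nat.
Qed.

Lemma alternating_telescope (R : pzRingType) (u : nat -> R) m : odd m ->
  \sum_(l < m) (-1) ^+ l * (u l + u l.+1) = u 0%N + u m.
Proof.
(* The induction needs a form valid for every [m]; parity only fixes the last sign. *)
move=> m_odd; suff -> : \sum_(l < m) (-1) ^+ l * (u l + u l.+1)
    = u 0%N - (-1) ^+ m * u m by rewrite -signr_odd m_odd mulN1r opprK.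
elim: m {m_odd} => [|m IHm]; first by rewrite big_ord0 mul1r subrr.
by rewrite big_ord_recr /= IHm exprS mulrDr mulN1r mulNr opprK addrA subrK.
Qed.

Lemma poly_rat_nat_unit k : k.+1%:R \is a @GRing.unit {poly rat}.
Proof.
rewrite -polyC_natr poly_unitE size_polyC coefC eqxx unitfE.
by rewrite Num.Theory.pnatr_eq0.
Qed.

Local Notation half w := ((w%:R / 2)%:P : {poly rat}).
Local Notation den w := (fps_add (fps_const 1) (pow_1m4t (half w))).

Lemma wCatalan_gfE w n :
  fps_mul (den w) (wCatalan_gf w) n = 2 * pow_1m4t (half w * 'X) n.
Proof.
rewrite /wCatalan_gf /= fps_mulA -fps_mul_constl.
apply: eq_fps_mul => // k; rewrite /fps_div fps_mulCA fps_mulC.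
rewrite -[RHS]mul1r -fps_mul_constl.
by apply: eq_fps_mul => //; apply/fps_mulfV/wCatalan_den_unit.
Qed.

(** Apply [phi] coefficientwise to [wCatalan_gfE]: since [phi] fixes w/2 it fixes the denominator,
    and only ['X] changes. Substitution of a polynomial for x is such a [phi]. *)
Lemma wCatalan_gf_mapE w (phi : {rmorphism {poly rat} -> {poly rat}}) n :
  phi (half w) = half w ->
  fps_mul (den w) (phi \o wCatalan_gf w) n = 2 * pow_1m4t (half w * phi 'X) n.
Proof.
move=> phi_half; have phi_pow := pow_1m4t_map phi poly_rat_nat_unit.
have := congr1 phi (wCatalan_gfE w n).
rewrite (rmorphM phi) rmorph_nat phi_pow (rmorphM phi) phi_half fps_mul_map => <-.
apply: eq_fps_mul => // k.
rewrite /fps_add /comp rmorphD phi_pow phi_half /fps_const.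
by case: eqP; rewrite ?rmorph1 ?rmorph0.
Qed.

Lemma wCatalan_comp_gfE w (q : {poly rat}) n :
  fps_mul (den w) (fun k => wCatalan k w \Po q) n = 2 * pow_1m4t (half w * q) n.
Proof.
rewrite -[in RHS](comp_polyX q).
by apply: (@wCatalan_gf_mapE w (comp_poly q)); apply: comp_polyC.
Qed.

(** Signs act by the ring product here rather than by scaling, to fit [fps_mul_sumr]. *)
Definition alternating_wCatalan (w1 w2 : nat) : fps {poly rat} := fun n =>
  \sum_(l < w1) (-1) ^+ l *
    (wCatalan n w1 \Po (w2%:R *: 'X + (w2%:R / w1%:R * l%:R)%:P)).

Lemma alternating_wCatalan_gfE w1 w2 n : odd w1 ->
  fps_mul (den w2) (fps_mul (den w1) (alternating_wCatalan w1 w2)) n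
  = 2 * (pow_1m4t (((w1 * w2)%:R / 2) *: 'X) n
         + pow_1m4t (((w1 * w2)%:R / 2) *: 'X + half (w1 * w2)%N) n).
Proof.
move=> w1_odd.
(* This exponent is (w1/2)(w2 x + (w2/w1) l). Consecutive values differ by w2/2, which is why
   multiplying by [den w2] produces a telescoping sum. *)
pose c l : {poly rat} := ((w1 * w2)%:R / 2) *: 'X + (l%:R * (w2%:R / 2))%:P.
have w1_neq0 : w1%:R != 0 :> rat.
  by rewrite Num.Theory.pnatr_eq0 -lt0n odd_gt0.
transitivity (fps_mul (den w2)
    (fun k => \sum_(l < w1) ((-1) ^+ l * 2) * pow_1m4t (c l) k) n).
  apply: eq_fps_mul => // k; rewrite fps_mul_sumr; apply: eq_bigr => l _.
  rewrite wCatalan_comp_gfE mulrA; congr (_ * pow_1m4t _ _).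
  rewrite /c mulrDr mul_polyC scalerA -polyCM natrM.
  by congr (_ *: _ + _%:P); field.
rewrite fps_mul_sumr.
transitivity (2 * \sum_(l < w1) (-1) ^+ l * (pow_1m4t (c l) n + pow_1m4t (c l.+1) n)).
  rewrite mulr_sumr; apply: eq_bigr => l _.
  rewrite fps_mul_1Dpow_1m4t; last exact: poly_rat_nat_unit.
  have -> : c l + half w2 = c l.+1.
    by rewrite /c -addrA -polyCD -[l.+1]addn1 natrD mulrDl mul1r.
  ring.
rewrite (alternating_telescope (fun l => pow_1m4t (c l) n)) // /c mul0r addr0.
by rewrite natrM mulrA.
Qed.

Lemma alternating_wCatalanC w1 w2 : odd w1 -> odd w2 ->
  alternating_wCatalan w1 w2 =1 alternating_wCatalan w2 w1.
Proof.
move=> w1_odd w2_odd.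
apply: (fps_mul_inj (wCatalan_den_unit w1)).
apply: (fps_mul_inj (wCatalan_den_unit w2)) => n.
(* Swapping the two denominators on the right makes the same lemma apply with [w1] and [w2]
   exchanged. *)
rewrite alternating_wCatalan_gfE // fps_mulCA alternating_wCatalan_gfE //.
by rewrite mulnC.
Qed.

Theorem theorem5 (n w1 w2 : nat) (hw1 : odd w1) (hw2 : odd w2) :
  \sum_(l < w1) (-1) ^+ l *:
      (wCatalan n w1 \Po (w2%:R *: 'X + (w2%:R / w1%:R * l%:R)%:P)) =
  \sum_(l < w2) (-1) ^+ l *:
      (wCatalan n w2 \Po (w1%:R *: 'X + (w1%:R / w2%:R * l%:R)%:P))
  :> {poly rat}.
Proof.
have signE l (p : {poly rat}) : (-1) ^+ l *: p = (-1) ^+ l * p.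
  by rewrite -mul_polyC rmorphXn rmorphN1.
under eq_bigr do rewrite signE; under [RHS]eq_bigr do rewrite signE.
exact: alternating_wCatalanC.
Qed.
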